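(* For any $\epsilon>0$, with probability tending to $1$ as $n\to\infty$, a uniformly random automaton with $n$ states over the alphabet $\{a,b\}$ has no synchronizing word of length shorter than $n^{\frac13-\epsilon}$.
   Context: An automaton with $n$ states on the alphabet $\{a,b\}$ is a pair of maps $a,b:[n]\to[n]$; a uniformly random automaton is chosen uniformly among the $n^{2n}$ such pairs. A word $\omega=\omega_1\cdots\omega_t$ acts by $\omega(u)=\omega_t(\cdots\omega_1(u)\cdots)$ and has length $t$; it is synchronizing if there is $v_0\in[n]$ with $\omega(u)=v_0$ for all $u\in[n]$. *)

(* Defs.v *)
From mathcomp Require Import all_boot all_order all_algebra.
From mathcomp Require Import boolp.
From mathcomp Require Import reals.
Set Implicit Arguments.
Unset Strict Implicit.
Unset Printing Implicit Defensive.
Import GRing.Theory Num.Theory.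
Local Open Scope ring_scope.

(* The pair of transition maps (a, b). *)
Definition automaton (n : nat) : finType :=
  ({ffun 'I_n -> 'I_n} * {ffun 'I_n -> 'I_n})%type.

Inductive letter : Set := La | Lb.

Definition word : Type := seq letter.

Definition step n (A : automaton n) (u : 'I_n) (x : letter) : 'I_n :=
  match x with La => A.1 u | Lb => A.2 u end.

(* The first letter of the word acts first. *)
Definition act n (A : automaton n) (w : word) (u : 'I_n) : 'I_n :=
  foldl (step A) u w.

Definition synchronizing n (A : automaton n) (w : word) : Prop :=
  exists v0 : 'I_n, forall u : 'I_n, act A w u = v0.

Definition finuniform_prob (R : realType) (T : finType) (E : T -> Prop) : R :=
  #|[set x : T | `[< E x >]]|%:R / #|T|%:R.

(* Main.v *)
(** Fix a word [w] of length [t] and a state [v0], and reveal the transitions of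
    a random automaton lazily, along the trajectories read by [w] from states
    not met so far.  If [w] sends every state to [v0], each such trajectory must
    enter the set of states met by the previous ones (or [v0]).  That set
    has at most [K = 1 + j t] elements during the first [j] trajectories, and at
    each newly revealed transition it is hit with conditional probability at
    most [K / n]; hence the probability that [w] sends every state to [v0] is at
    most [(t K / n) ^ j].  Taking [j] slightly larger than [t], with
    [t <= n ^ (1/3 - e)], this survives the union bound over the [2 ^ t] words
    and the [n] choices of [v0].  Shorter synchronizing words are covered because
    they can be padded to length [t]. *)

Require Import Defs.
From mathcomp Require Import all_boot all_order all_algebra.
From mathcomp Require Import all_classical all_reals all_analysis.
From mathcomp Require Import zify ring lra.
Import Order.TTheory GRing.Theory Num.Theory.
Import numFieldNormedType.Exports.
Set Implicit Arguments.
Unset Strict Implicit.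
Unset Printing Implicit Defensive.

(** * Completions of a partially revealed function *)

Section LazyRevealing.

Definition fupd (X : finType) (Y : Type) (f : {ffun X -> Y}) (x : X) (y : Y) :
    {ffun X -> Y} :=
  [ffun z => if z == x then y else f z].

(** Exchanging [y] with the value [h x] is an involution on pairs, so overwriting a uniform [h] at
    [x] by a uniform [y] leaves it uniform. *)
Lemma sum_fupd (X Y : finType) (x : X) (F : {ffun X -> Y} -> nat) :
  \sum_y \sum_h F (fupd h x y) = #|Y| * \sum_h F h.
Proof.
rewrite pair_big /=.
pose swap (p : Y * {ffun X -> Y}) := (p.2 x, fupd p.2 x p.1).
have swapK : involutive swap.
  move=> [y h]; rewrite /swap /= ffunE eqxx; congr pair.
  by apply/ffunP => z; rewrite !ffunE; case: eqP => [->|].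
rewrite (reindex swap) /=; last by exists swap => p _; apply: swapK.
rewrite -sum_nat_const pair_big /=.
apply: eq_bigr => -[y h] _.
by have := swapK (y, h); rewrite /swap /= => -[_ ->].
Qed.

Variables (X Y : finType).
Implicit Types (g : {ffun X -> option Y}) (h : {ffun X -> Y}).
Implicit Types (P : pred {ffun X -> Y}).

Definition complete g h : {ffun X -> Y} := [ffun x => odflt (h x) (g x)].

(* [h] ranges over all functions, also on the domain of [g]: this is [#|Y| ^ #|X|]
   times a conditional probability, so bounds need not track the size of that
   domain. *)
Definition completions g P : nat := \sum_h P (complete g h).

(** Law of total probability: reveal the value at [x] and average over it. *)
Lemma sum_completions_fupd g P x : g x = None ->
  \sum_y completions (fupd g x (Some y)) P = #|Y| * completions g P.
Proof.
move=> gx; rewrite -(sum_fupd x); apply: eq_bigr => y _; apply: eq_bigr => h _.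
congr (nat_of_bool (P _)); apply/ffunP => z; rewrite !ffunE.
by case: eqP => [->|//]; rewrite gx.
Qed.

Lemma leq_completions g P1 P2 : (forall h, P1 (complete g h) -> P2 (complete g h)) ->
  completions g P1 <= completions g P2.
Proof.
move=> sub12; apply: leq_sum => h _.
by case: (P1 _) (sub12 h) => // ->.
Qed.

Lemma leq_completions_total g P : completions g P <= #|{ffun X -> Y}|.
Proof. by rewrite -sum1_card; apply: leq_sum => h _; apply: leq_b1. Qed.

End LazyRevealing.

(** * Trajectories of a fixed word *)

Section FixedWord.

Variables (Q B : finType).

Definition run (f : Q * B -> Q) (u : Q) (s : seq B) : Q :=
  foldl (fun v b => f (v, b)) u s.

Definition sends_all_to (w : seq B) (v0 : Q) : pred {ffun Q * B -> Q} :=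
  fun f => [forall u, run f u w == v0].

Variables (w : seq B) (v0 : Q) (K : nat).
Hypothesis ltKQ : K < #|Q|.
Let N := #|{ffun Q * B -> Q}|.

(** The last condition reserves room below [K] for [j] more trajectories. As revealed transitions
    only leave states of [V], a trajectory started outside [V] meets fresh transitions until it
    enters [V] or returns to a state of its own. *)
Definition completions_bound (j : nat) : Prop :=
  forall (g : {ffun Q * B -> option Q}) (V : {set Q}),
    v0 \in V -> (forall x, g x -> x.1 \in V) -> #|V| + j * size w <= K ->
  completions g (sends_all_to w v0) * #|Q| ^ j <= N * (size w * K) ^ j.

(* [W] collects the states left so far by the current trajectory, now in [v]
   with [s] still to read; it has avoided [V] and must enter it to reach [v0]. *)
Lemma completions_trajectory (j : nat) (s : seq B)
    (g : {ffun Q * B -> option Q}) (V W : {set Q}) (v : Q) :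
    completions_bound j -> v0 \in V -> v \notin V ->
    (forall x, g x -> x.1 \in V :|: W) ->
    (forall x y, x.1 \notin V -> g x = Some y -> y \notin V) ->
    #|V| + #|W| + size s + j * size w <= K ->
  completions g (fun f => sends_all_to w v0 f && (run f v s == v0)) * #|Q| ^ j.+1
    <= N * (size s * K) * (size w * K) ^ j.
Proof.
move=> IHj v0V; elim: s g W v => [|b s IHs] g W v vV gVW gV leK.
  (* The trajectory ends outside [V], hence not at [v0]: the count is zero. *)
  rewrite /completions big1 // => h _ /=.
  by rewrite (_ : v == v0 = false) ?andbF //; apply: contraNF vV => /eqP ->.
case gvb : (g (v, b)) => [y|].
  (* A transition revealed earlier on this trajectory cannot enter [V]; one letter is consumed at no
     cost. *)
  have yV : y \notin V by apply: gV gvb.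
  have := IHs g W y yV gVW gV ltac:(move: leK => /=; lia).
  have -> : completions g (fun f => sends_all_to w v0 f && (run f v (b :: s) == v0))
          = completions g (fun f => sends_all_to w v0 f && (run f y s == v0)).
    by apply: eq_bigr => h _ /=; rewrite {2}/complete ffunE gvb.
  move/leq_trans; apply; rewrite leq_mul2r leq_mul2l leq_mul2r /=.
  by rewrite leqnSn !orbT.
have Q0 : 0 < #|Q| by lia.
(* Reveal the transition at [(v, b)]. At most [K] of its values lie in [V]; for these [IHj] applies,
   with all states left so far added to [V]. For the other values the trajectory goes on with
   [s]. *)
rewrite -(leq_pmul2l Q0) mulnA -(sum_completions_fupd _ gvb) big_distrl /=.
rewrite (bigID (mem V)) /=.
pose M := N * (size w * K) ^ j.
have hit y : y \in V ->
  completions (fupd g (v, b) (Some y))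
    (fun f => sends_all_to w v0 f && (run f v (b :: s) == v0)) * #|Q| ^ j.+1
  <= #|Q| * M.
  move=> yV; rewrite expnS mulnCA leq_mul2l; apply/orP; right.
  apply: leq_trans (IHj (fupd g (v, b) (Some y)) (V :|: (v |: W)) _ _ _).
  - by rewrite leq_mul2r leq_completions ?orbT // => h /andP[].
  - by rewrite inE v0V.
  - move=> x; rewrite ffunE; case: eqP => [-> _|_ /gVW]; rewrite !inE /= ?eqxx ?orbT //.
    by case/orP => ->; rewrite ?orbT.
  - have := (leq_card_setU V (v |: W)).1; have := (leq_card_setU [set v] W).1.
    rewrite /= cards1; move: leK => /=; lia.
have miss y : y \notin V ->
  completions (fupd g (v, b) (Some y))
    (fun f => sends_all_to w v0 f && (run f v (b :: s) == v0)) * #|Q| ^ j.+1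
  <= size s * K * M.
  move=> yV.
  have bound := IHs (fupd g (v, b) (Some y)) (v |: W) y yV.
  rewrite /M mulnCA mulnA; apply: leq_trans (bound _ _ _).
  - rewrite leq_mul2r leq_completions ?orbT // => h /=.
    by rewrite {2}/complete !ffunE eqxx.
  - move=> x; rewrite ffunE; case: eqP => [-> _|_ /gVW]; rewrite !inE /= ?eqxx ?orbT //.
    by case/orP => ->; rewrite ?orbT.
  - by move=> x z xV; rewrite ffunE; case: eqP => [_ [<-]|_ /gV]; last apply.
  - have := (leq_card_setU [set v] W).1.
    rewrite cards1; move: leK => /=; lia.
apply: leq_trans (leq_add (leq_sum _ hit) (leq_sum _ miss)) _.
rewrite !sum_nat_const.
have leVK : #|V| <= K by lia.
have leCQ : #|[pred y | y \notin V]| <= #|Q| by apply: max_card.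
apply: leq_trans (leq_add (leq_mul leVK (leqnn _)) (leq_mul leCQ (leqnn _))) _.
by rewrite /M; apply/eq_leq; ring.
Qed.

Lemma completions_bound_all (j : nat) : completions_bound j.
Proof.
elim: j => [|j IHj] g V v0V gV leK.
  by rewrite !expn0 !muln1 leq_completions_total.
(* Since [#|V| <= K < #|Q|], a fresh state remains to start the next trajectory. *)
have [u uV] : exists u, u \notin V.
  apply/existsP; rewrite -negb_forall; apply: contraL ltKQ => /forallP allV.
  rewrite -leqNgt (leq_trans _ (leq_trans (leq_addr _ _) leK)) //.
  by rewrite -cardsT subset_leq_card //; apply/fintype.subsetP => x _; apply: allV.
have bound := completions_trajectory (s := w) (g := g) (W := finset.set0) IHj v0V uV.
rewrite [(_ * K) ^ _]expnS mulnA; apply: leq_trans (bound _ _ _).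
- rewrite leq_mul2r leq_completions ?orbT // => h Ph.
  by rewrite Ph (forallP Ph).
- by move=> x /gV; rewrite finset.setU0.
- by move=> x y xV gx; case/negP: xV; apply: gV; rewrite gx.
- by rewrite cards0; lia.
Qed.

End FixedWord.

Lemma card_sends_all_to (Q B : finType) (w : seq B) (v0 : Q) (j : nat) :
    1 + j * size w < #|Q| ->
  #|sends_all_to w v0| * #|Q| ^ j
    <= #|{ffun Q * B -> Q}| * (size w * (1 + j * size w)) ^ j.
Proof.
move=> ltQ; have := @completions_bound_all Q B w v0 _ ltQ j [ffun=> None] [set v0].
rewrite inE eqxx cards1 => /(_ isT) bound.
have -> : #|sends_all_to w v0| = completions [ffun=> None] (sends_all_to w v0).
  rewrite -sum1_card big_mkcond; apply: eq_bigr => h _.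
  have -> : complete [ffun=> None] h = h by apply/ffunP => x; rewrite !ffunE.
  by rewrite unfold_in /sends_all_to; case: ifP.
by apply: bound => // x; rewrite ffunE.
Qed.

(** * Union bound over words and target states *)

Definition sync_in (Q B : finType) (t : nat) : pred {ffun Q * B -> Q} :=
  fun f => [exists w : t.-tuple B, exists v0, sends_all_to w v0 f].

Lemma card_sync_in (Q B : finType) (t j : nat) : 1 + j * t < #|Q| ->
  #|@sync_in Q B t| * #|Q| ^ j
    <= #|B| ^ t * #|Q| * #|{ffun Q * B -> Q}| * (t * (1 + j * t)) ^ j.
Proof.
move=> ltQ.
have le_union : #|@sync_in Q B t| <=
    \sum_(p : t.-tuple B * Q) #|@sends_all_to Q B p.1 p.2|.
  rewrite -sum1_card big_mkcond /=.
  under [leqRHS]eq_bigr do rewrite -sum1_card big_mkcond /=.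
  rewrite exchange_big /=; apply: leq_sum => f _.
  rewrite unfold_in; case: ifP => // /existsP[w /existsP[v0 Pf]].
  by rewrite (bigD1 (w, v0)) //= ifT.
apply: leq_trans (leq_mul le_union (leqnn _)) _.
rewrite big_distrl /= -!mulnA [leqRHS]mulnA -(card_tuple t B) -card_prod -sum_nat_const.
apply: leq_sum => -[w v0] _ /=.
by have := @card_sends_all_to Q B w v0 j; rewrite size_tuple; apply.
Qed.

(** * Automata as transition tables *)

Definition is_La (x : letter) : bool := if x is La then true else false.

Definition transition_table n (A : automaton n) : {ffun 'I_n * bool -> 'I_n} :=
  [ffun p => step A p.1 (if p.2 then La else Lb)].

Lemma transition_table_inj n : injective (@transition_table n).
Proof.
move=> [a b] [a' b'] /ffunP eqAA'; congr pair; apply/ffunP => u.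
  by have := eqAA' (u, true); rewrite !ffunE.
by have := eqAA' (u, false); rewrite !ffunE.
Qed.

Lemma card_automaton n : #|automaton n| = #|{ffun 'I_n * bool -> 'I_n}|.
Proof. by rewrite card_prod !card_ffun card_prod card_bool card_ord -expnD; congr expn; lia. Qed.

Lemma run_transition_table n (A : automaton n) (w : word) (u : 'I_n) :
  run (transition_table A) u (map is_La w) = act A w u.
Proof.
elim: w u => //= x w IHw u.
by rewrite IHw ffunE /=; case: x.
Qed.

Lemma synchronizing_sync_in n (A : automaton n) (w : word) (t : nat) :
  synchronizing A w -> size w <= t -> sync_in t (transition_table A).
Proof.
move=> [v0 sync_w] le_wt; pose pad := nseq (t - size w) La.
have size_pad : size (map is_La (w ++ pad)) == t.
  by rewrite size_map size_cat size_nseq subnKC.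
(* The padding letters carry the common state [v0] on to a new target. *)
apply/existsP; exists (Tuple size_pad); apply/existsP; exists (act A pad v0).
apply/forallP => u; rewrite run_transition_table.
by rewrite /act foldl_cat -/(act A w u) sync_w.
Qed.

Lemma card_synchronizing_le n (t : nat) (E : automaton n -> Prop) :
    (forall A, E A -> exists2 w : word, synchronizing A w & size w <= t) ->
  #|[set A | `[< E A >]]| <= #|@sync_in 'I_n bool t|.
Proof.
move=> EP; rewrite -(card_imset _ (@transition_table_inj n)).
apply/subset_leq_card/fintype.subsetP => _ /imsetP[A + ->].
by rewrite inE => /asboolP/EP[w sync_w le_wt]; apply: synchronizing_sync_in sync_w le_wt.
Qed.

(** * Probabilities and asymptotics *)

Local Open Scope ring_scope.

Lemma finuniform_probC (R : realType) (T : finType) (E : T -> Prop) :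
  (0 < #|T|)%N ->
  finuniform_prob R (fun x => ~ E x) = 1 - finuniform_prob R E.
Proof.
move=> T0; rewrite /finuniform_prob -(cardsC [set x | `[< E x >]]) natrD.
have -> : [set x | `[< ~ E x >]] = ~: [set x | `[< E x >]].
  by apply/setP => x; rewrite !inE asbool_neg.
have : (#|[set x | `[< E x >]]| + #|~: [set x | `[< E x >]]|)%:R != 0 :> R.
  by rewrite cardsC pnatr_eq0 -lt0n.
by rewrite natrD => ?; field.
Qed.

Lemma finuniform_prob_synchronizing_le (R : realType) (n t j : nat)
    (E : automaton n -> Prop) :
    (forall A, E A -> exists2 w : word, synchronizing A w & (size w <= t)%N) ->
    (1 + j * t < n)%N ->
  finuniform_prob R E <= 2 ^+ t * n%:R * ((t * (1 + j * t))%:R / n%:R) ^+ j.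
Proof.
move=> EP ltn; have := card_synchronizing_le EP.
have := @card_sync_in 'I_n bool t j; rewrite card_ord card_bool => /(_ ltn).
rewrite /finuniform_prob card_automaton; set N := #|{ffun _ -> _}| => le1 le2.
have N0 : (0 < N)%N by rewrite /N card_ffun card_ord expn_gt0; lia.
rewrite expr_div_n mulrA ler_pdivrMr ?ltr0n // mulrAC ler_pdivlMr; last first.
  by rewrite exprn_gt0 // ltr0n; lia.
rewrite -!natrX -!natrM ler_nat (leq_trans _ (leq_trans le1 _)) //.
  by rewrite leq_mul2r le2 orbT.
by apply/eq_leq; ring.
Qed.

(* With [t <= n^(1/3 - e)] and [j = t + j0], the factor raised to the power [j]
   is at most [C n^(-3e)]: it beats the [2 ^ t] words as soon as it is at most
   [1/2], and the [j0] extra factors beat the [n] possible target states. *)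
Lemma union_bound_le (R : realType) (e : R) (n t j0 : nat) :
    0 < e -> (0 < t)%N -> (0 < n)%N -> t%:R <= n%:R `^ (1 / 3 - e) :> R ->
    2 <= 3 * e * j0%:R -> 2 * (2 + j0)%:R <= n%:R `^ (3 * e) :> R ->
  ((1 + (t + j0) * t < n)%N) /\
  2 ^+ t * n%:R * ((t * (1 + (t + j0) * t))%:R / n%:R) ^+ (t + j0)
    <= (2 + j0)%:R ^+ j0 / n%:R :> R.
Proof.
move=> e0 t0 n0 le_t le_j0 le_C.
have n0R : 0 < n%:R :> R by rewrite ltr0n.
pose D : R := n%:R `^ (3 * e).
have D0 : 0 < D by rewrite powR_gt0.
have t3 : t%:R ^+ 3 * D <= n%:R :> R.
  have -> : n%:R = (n%:R `^ (1 / 3 - e)) ^+ 3 * D :> R.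
    rewrite -powR_mulrn ?powR_ge0 // -powRrM -powRD; last first.
      by apply/implyP => _; rewrite gt_eqF.
    by rewrite (_ : (1 / 3 - e) * 3 + 3 * e = 1) ?powRr1 //; field.
  by rewrite ler_pM2r // lerXn2r ?nnegrE ?powR_ge0.
have le_num : (t * (1 + (t + j0) * t) <= (2 + j0) * t ^ 3)%N.
  by rewrite !expnS expn0; nia.
pose q : R := (t * (1 + (t + j0) * t))%:R / n%:R.
have q0 : 0 <= q by rewrite divr_ge0.
have qD : q * D <= (2 + j0)%:R.
  rewrite mulrAC ler_pdivrMr //.
  apply: le_trans (_ : ((2 + j0) * t ^ 3)%:R * D <= _).
    by rewrite ler_pM2r // ler_nat.
  by rewrite natrM natrX -mulrA ler_wpM2l.
have q2 : 2 * q <= 1.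
  by rewrite -(ler_pM2r D0) mul1r -mulrA (le_trans _ le_C) // ler_pM2l.
split.
  have : (2 * (t * (1 + (t + j0) * t)) <= n)%N.
    by move: q2; rewrite /q mulrA ler_pdivrMr // mul1r -natrM ler_nat.
  by apply: leq_trans; rewrite mulnA ltn_Pmull // mul2n -addnn (leq_add t0 t0).
(* Here [(2 * q) ^+ t <= 1] absorbs the words. *)
rewrite -/q exprD mulrACA -exprMn.
apply: le_trans (_ : 1 * (n%:R * q ^+ j0) <= _).
  by rewrite ler_wpM2r ?mulr_ge0 ?exprn_ge0 // exprn_ile1 // mulr_ge0.
rewrite mul1r ler_pdivlMr // mulrAC -expr2.
(* One factor [n] cancels the choices of target, the other gives the decay. *)
have leD : n%:R ^+ 2 <= D ^+ j0 :> R.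
  rewrite /D -!powR_mulrn ?powR_ge0 // -powRrM ler_powR //.
  by rewrite ler1n.
apply: le_trans (_ : D ^+ j0 * q ^+ j0 <= _).
  by rewrite ler_wpM2r ?exprn_ge0.
by rewrite -exprMn lerXn2r ?nnegrE ?mulr_ge0 // ?(ltW D0) // mulrC.
Qed.

Local Open Scope classical_set_scope.

Theorem theorem1p4 (R : realType) (eps : R) (heps : 0 < eps) :
  finuniform_prob R (fun A : automaton n =>
    ~ exists w : word,
        synchronizing A w /\ (size w)%:R < n%:R `^ (1 / 3 - eps))
    @[n --> \oo] --> (1 : R).
Proof.
(* Capping at [1 / 3] keeps the exponent [1 / 3 - e] nonnegative, so that [t >= 1]; lowering [eps]
   only allows longer words. *)
pose e : R := Num.min eps (1 / 3).
have e0 : 0 < e by rewrite lt_min heps; lra.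
have le_e : e <= eps /\ e <= 1 / 3 by rewrite !ge_min !lexx orbT.
have [j0 le_j0] : exists j0 : nat, 2 <= 3 * e * j0%:R.
  exists (Num.truncn (2 / (3 * e))).+1.
  by rewrite mulrC -ler_pdivrMr ?mulr_gt0 // ltW // truncnS_gt.
pose C : R := (2 + j0)%:R ^+ j0.
apply: (@squeeze_cvgr _ _ _ _ (fun n => 1 - C * n%:R^-1) (fun=> 1)); last 2 first.
- rewrite -[X in _ --> X]subr0 -[X in _ - X](mulr0 C).
  apply: cvgB; first exact: cvg_cst.
  apply: cvgM; first exact: cvg_cst.
  rewrite -cvg_shiftS; exact: cvg_harmonic.
- exact: cvg_cst.
near=> n.
have n0 : (0 < n)%N by near: n; exact: nbhs_infty_gt.
have n0R : 0 < n%:R :> R by rewrite ltr0n.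
have n1R : 1 <= n%:R :> R by rewrite ler1n.
have le_C : 2 * (2 + j0)%:R <= n%:R `^ (3 * e).
  have le_n : (2 * (2 + j0)%:R) `^ (3 * e)^-1 <= n%:R by near: n; exact: nbhs_infty_ger.
  have e3 : 0 < 3 * e by rewrite mulr_gt0.
  have -> : 2 * (2 + j0)%:R = ((2 * (2 + j0)%:R) `^ (3 * e)^-1) `^ (3 * e) :> R.
    by rewrite -powRrM mulVf ?gt_eqF // powRr1 // mulr_ge0.
  by apply: ge0_ler_powR; rewrite ?nnegrE ?powR_ge0 // ltW.
have automaton0 : (0 < #|automaton n|)%N.
  by rewrite card_automaton card_ffun card_ord expn_gt0 n0.
pose t := Num.truncn (n%:R `^ (1 / 3 - e) : R).
have le_t : t%:R <= n%:R `^ (1 / 3 - e) :> R by rewrite truncn_le ?powR_ge0.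
have t0 : (0 < t)%N.
  rewrite truncn_gt0 -[leLHS](powRr0 n%:R) ler_powR //; lra.
have [ltjt le_bound] := union_bound_le e0 t0 n0 le_t le_j0 le_C.
rewrite finuniform_probC //; set p := finuniform_prob _ _.
have p0 : 0 <= p by rewrite divr_ge0.
suff : p <= C / n%:R by move=> le_p; rewrite lerD2l lerN2 le_p gerBl.
apply: le_trans le_bound; apply: finuniform_prob_synchronizing_le ltjt.
move=> A [w [sync_w lt_w]]; exists w => //.
have le_w : (size w)%:R <= n%:R `^ (1 / 3 - e) :> R.
  apply: ltW (lt_le_trans lt_w _); rewrite ler_powR //; lra.
by rewrite truncn_ge_nat ?powR_ge0.
Unshelve. all: by end_near. Qed.
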